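(* Let $(M,g)$ be a closed shrinking Ricci soliton of dimension $N\ge4$ with Ricci potential $f$. Then its $Q$-curvature is $$Q_g=(2\mathbf a-\mathbf c)|Ric_g|_g^2+\mathbf bR_g^2-2\mathbf aR_g-2\mathbf a\,Ric_g(\nabla f,\nabla f),$$ where $$\mathbf a=\frac1{2(N-1)},\qquad\mathbf b=\frac{N^3-4N^2+16N-16}{8(N-1)^2(N-2)^2},\qquad\mathbf c=\frac2{(N-2)^2}.$$ If moreover $(M,g)$ has radially positive Ricci curvature, i.e. $Ric_g(\nabla f,\nabla f)>0$, and - for $N=4$: $R_g^2>|Ric_g|_g^2+2R_g+2Ric_g(\nabla f,\nabla f)$; or - for $N>4$: $(2\mathbf a-\mathbf c)|Ric_g|_g^2>2\mathbf a\,Ric_g(\nabla f,\nabla f)>0$ and $R_g>2\mathbf a/\mathbf b$, then $Q_g>0$.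
   Context: A Ricci soliton is a Riemannian metric $g$ on a closed manifold $M$ with $Ric_g+\mathrm{Hess}_g(f)=\mu g$ for a constant $\mu\in\{-1,0,1\}$ and a smooth function $f$, the Ricci potential; it is shrinking if $\mu=1$. $R_g$ is the scalar curvature, $|Ric_g|_g$ the norm of the Ricci tensor, $\Delta_g=\mathrm{div}_g\nabla_g$. The $Q$-curvature (associated with the Paneitz–Branson operator, $m=2$) is $Q_g=-\mathbf a\Delta_gR_g+\mathbf bR_g^2-\mathbf c|Ric_g|_g^2$ with the constants $\mathbf a,\mathbf b,\mathbf c$ of the statement. *)

(* Defs.v *)
From HB Require Import structures.
From mathcomp Require Import all_boot all_order all_algebra.
From mathcomp Require Import all_classical all_reals all_analysis.
Import Order.TTheory GRing.Theory Num.Theory.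
Import numFieldNormedType.Exports.

Set Implicit Arguments.
Unset Strict Implicit.
Unset Printing Implicit Defensive.

Local Open Scope classical_set_scope.
Local Open Scope ring_scope.

Section Smooth.
Variables (R : realType) (N : nat).
Implicit Types (U : set 'rV[R]_N) (h : 'rV[R]_N -> R).

Definition partial (i : 'I_N) h (x : 'rV[R]_N) : R := 'D_(delta_mx 0 i) h x.

(* The maps below are total functions of which only the restriction to the
   open set [U] is meaningful. *)
Fixpoint Ck_on (k : nat) U h : Prop :=
  (forall x, U x -> {for x, continuous h}) /\
  match k with
  | 0 => True
  | k'.+1 => forall i : 'I_N,
      (forall x, U x -> derivable h x (delta_mx 0 i)) /\
      Ck_on k' U (partial i h)
  end.

Definition smooth_on U h : Prop := forall k, Ck_on k U h.

End Smooth.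

(* A compact Hausdorff space without boundary, with a smooth atlas of
   dimension N.  The atlas need not be maximal; second countability follows
   from compactness.  The values of [chart c] outside [chart_dom c], and of
   [chart_inv c] outside the image of [chart c], are irrelevant. *)
Record closedManifold (R : realType) (N : nat) := ClosedManifold {
  mfd_space :> topologicalType;
  mfd_compact : compact [set: mfd_space];
  mfd_hausdorff : hausdorff_space mfd_space;
  chart_index : Type;
  chart_dom : chart_index -> set mfd_space;
  chart : chart_index -> mfd_space -> 'rV[R]_N;
  chart_inv : chart_index -> 'rV[R]_N -> mfd_space;
  chart_cover : forall p, exists c, chart_dom c p;
  chart_dom_open : forall c, open (chart_dom c);
  chart_img_open : forall c, open (chart c @` chart_dom c);
  chartK : forall c, {in chart_dom c, cancel (chart c) (chart_inv c)};
  chart_continuous : forall c, {within chart_dom c, continuous (chart c)};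
  chart_inv_continuous : forall c,
    {within chart c @` chart_dom c, continuous (chart_inv c)};
  transition_smooth : forall c d (k : 'I_N),
    smooth_on (chart c @` (chart_dom c `&` chart_dom d))
              (fun x => chart d (chart_inv c x) 0 k)
}.

Definition chart_img (R : realType) (N : nat) (M : closedManifold R N)
    (c : chart_index M) : set 'rV[R]_N :=
  chart c @` chart_dom c.

Definition transition (R : realType) (N : nat) (M : closedManifold R N)
    (c d : chart_index M) (x : 'rV[R]_N) : 'rV[R]_N :=
  chart d (chart_inv c x).

Definition smooth_fun (R : realType) (N : nat) (M : closedManifold R N)
    (f : M -> R) : Prop :=
  forall c, smooth_on (chart_img c) (f \o chart_inv c).

(* [met g c x] is the matrix (g_ij) of the metric in the coordinates of the
   chart c, at the point of coordinates x.  Since ['J F x] has (a, k) entry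
   the a-th partial derivative of the k-th component of F, [met_change] says
   that g_ab = (d_a y^k) (d_b y^l) g'_kl. *)
Record riemannianMetric (R : realType) (N : nat) (M : closedManifold R N) :=
  RiemannianMetric {
  met :> chart_index M -> 'rV[R]_N -> 'M[R]_N;
  met_smooth : forall c i j, smooth_on (chart_img c) (fun x => met c x i j);
  met_sym : forall c x, chart_img c x -> (met c x)^T = met c x;
  met_pos : forall c x, chart_img c x ->
    forall v : 'rV[R]_N, v != 0 -> 0 < (v *m met c x *m v^T) 0 0;
  met_change : forall c d p, chart_dom c p -> chart_dom d p ->
    let J := 'J (transition c d) (chart c p) in
    met c (chart c p) = J *m met d (chart d p) *m J^T
}.

Section Curvature.
Variables (R : realType) (N : nat).
(* components of a metric in some coordinate system *)
Variable G : 'rV[R]_N -> 'M[R]_N.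
Implicit Types (x : 'rV[R]_N) (h : 'rV[R]_N -> R).

Definition ginv x : 'M[R]_N := invmx (G x).

(* Gamma^k_ij *)
Definition christoffel (k i j : 'I_N) x : R :=
  2^-1 * \sum_l ginv x k l *
    (partial i (fun y => G y j l) x + partial j (fun y => G y i l) x
     - partial l (fun y => G y i j) x).

(* Riem(d_i, d_j) d_k = \sum_l riem l i j k d_l, where
   Riem(X, Y) Z = nabla_X nabla_Y Z - nabla_Y nabla_X Z - nabla_[X,Y] Z *)
Definition riem (l i j k : 'I_N) x : R :=
  partial i (christoffel l j k) x - partial j (christoffel l i k) x
  + \sum_m (christoffel l i m x * christoffel m j k x
            - christoffel l j m x * christoffel m i k x).

(* Ric(Y, Z) = trace (X |-> Riem(X, Y) Z) *)
Definition ricci x : 'M[R]_N := \matrix_(j, k) \sum_i riem i i j k x.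

(* trace and squared norm, with respect to the metric, of the bilinear form
   with matrix T at x *)
Definition met_trace x (T : 'M[R]_N) : R := \sum_i \sum_j ginv x i j * T i j.

Definition met_norm2 x (T : 'M[R]_N) : R :=
  \sum_i \sum_j \sum_k \sum_l ginv x i k * ginv x j l * T i j * T k l.

Definition scal x : R := met_trace x (ricci x).

Definition grad h x : 'rV[R]_N := \row_i \sum_j ginv x i j * partial j h x.

(* trace of the covariant derivative of the vector field X *)
Definition divergence (X : 'rV[R]_N -> 'rV[R]_N) x : R :=
  \sum_i (partial i (fun y => X y 0 i) x
          + \sum_k christoffel i i k x * X x 0 k).

Definition laplacian h x : R := divergence (grad h) x.

Definition hess h x : 'M[R]_N :=
  \matrix_(i, j) (partial i (partial j h) x
                  - \sum_k christoffel k i j x * partial k h x).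

Definition ricci_form x (v : 'rV[R]_N) : R := (v *m ricci x *m v^T) 0 0.

End Curvature.

Section QCurvature.
Variables (R : realType) (N : nat).

Definition Qa : R := (2 * (N%:R - 1))^-1.

Definition Qb : R :=
  (N%:R ^+ 3 - 4 * N%:R ^+ 2 + 16 * N%:R - 16)
  / (8 * (N%:R - 1) ^+ 2 * (N%:R - 2) ^+ 2).

Definition Qc : R := 2 / (N%:R - 2) ^+ 2.

Definition Qcurv (G : 'rV[R]_N -> 'M[R]_N) (x : 'rV[R]_N) : R :=
  - Qa * laplacian G (scal G) x + Qb * scal G x ^+ 2
  - Qc * met_norm2 G x (ricci G x).

End QCurvature.

Definition ricci_soliton (R : realType) (N : nat) (M : closedManifold R N)
    (g : riemannianMetric M) (f : M -> R) (mu : R) : Prop :=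
  [/\ [\/ mu = -1, mu = 0 | mu = 1],
      smooth_fun f &
      forall c x, chart_img c x ->
        ricci (g c) x + hess (g c) (f \o chart_inv c) x = mu *: g c x].

Definition shrinking_soliton (R : realType) (N : nat) (M : closedManifold R N)
    (g : riemannianMetric M) (f : M -> R) : Prop :=
  ricci_soliton g f 1.

Section GeometricQuantities.
Variables (R : realType) (N : nat) (M : closedManifold R N).
Variables (g : riemannianMetric M) (f : M -> R).

(* Scalar functions on M, expressed in the coordinates of the chart c. *)
Definition Scal (c : chart_index M) (x : 'rV[R]_N) : R := scal (g c) x.

Definition RicNorm2 (c : chart_index M) (x : 'rV[R]_N) : R :=
  met_norm2 (g c) x (ricci (g c) x).

Definition RicGrad (c : chart_index M) (x : 'rV[R]_N) : R :=
  ricci_form (g c) x (grad (g c) (f \o chart_inv c) x).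

Definition QCurv (c : chart_index M) (x : 'rV[R]_N) : R := Qcurv (g c) x.

End GeometricQuantities.

(* Main.v *)
(* The second Bianchi identity, contracted twice, is 2 div Ric = dR.  Differentiating
   Hess f = g - Ric and antisymmetrizing gives Riem(df) as a derivative of Ric,
   whose trace is div Ric - dR = - Ric(grad f).  Hence dR = 2 Ric(grad f), and
   taking the divergence once more
     Delta R = 2 Ric(grad f, grad f) + 2 R - 2 |Ric|^2,
   which turns the definition of Q into the stated formula.  The positivity
   statements are then arithmetic: for N = 4 one has a = b = 1/6 and c = 1/2,
   and for N > 4 one writes b R^2 - 2 a R = R (b R - 2 a). *)

Require Import Defs.
From HB Require Import structures.
From mathcomp Require Import all_boot all_order all_algebra ring lra.
From mathcomp Require Import all_classical all_reals all_analysis.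
Import Order.TTheory GRing.Theory Num.Theory.
Import numFieldNormedType.Exports.

Set Implicit Arguments.
Unset Strict Implicit.
Unset Printing Implicit Defensive.

Local Open Scope classical_set_scope.
Local Open Scope ring_scope.

(** The identities are polynomial in the components of the metric, of its inverse and of the
    potential, and in their partial derivatives. Carried out on functions, they would need a
    differentiability proof at every use of the Leibniz rule. Over an abstract ring with additive,
    commuting Leibniz operators [d i], each of them closes by [ring] on matrix entries; [half] and
    [h] are data because such a ring has no division. The analytic cost is paid once: smooth
    functions on the image of a chart must form such a ring. Commutation of the derivations is
    Schwarz's theorem, and the inverse metric requires reciprocals of nonvanishing smooth functions.
    Evaluation at a point then carries the result back to the coordinate formulas. *)

(* The coordinate formulas of Riemannian geometry over an abstract commutative
   ring with commuting derivations, standing for the smooth functions of a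
   chart. *)
Section TensorCalculus.
Variables (A : comPzRingType) (N : nat).
Variable d : 'I_N -> {additive A -> A}.
Hypothesis dM : forall i a b, d i (a * b) = d i a * b + a * d i b.
Hypothesis dC : forall i j a, d i (d j a) = d j (d i a).
Variable half : A.
Hypothesis halfK : half * 2 = 1.
Variables g h : 'M[A]_N.
Hypotheses (g_sym : g^T = g) (gK : h *m g = 1%:M) (hK : g *m h = 1%:M).
Variable phi : A.

Definition rchristoffel (k i j : 'I_N) : A :=
  half * \sum_l h k l * (d i (g j l) + d j (g i l) - d l (g i j)).

Definition rriem (l i j k : 'I_N) : A :=
  d i (rchristoffel l j k) - d j (rchristoffel l i k)
  + \sum_m (rchristoffel l i m * rchristoffel m j k
    - rchristoffel l j m * rchristoffel m i k).

Definition rricci : 'M[A]_N := \matrix_(j, k) \sum_i rriem i i j k.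

Definition rscal : A := \sum_i \sum_j h i j * rricci i j.

Definition rhess : 'M[A]_N :=
  \matrix_(i, j) (d i (d j phi) - \sum_k rchristoffel k i j * d k phi).

Definition rgrad (f : A) : 'rV[A]_N := \row_i \sum_j h i j * d j f.

Definition rlap (f : A) : A :=
  \sum_i (d i (rgrad f 0 i) + \sum_k rchristoffel i i k * rgrad f 0 k).

Definition rnorm2 (B : 'M[A]_N) : A :=
  \sum_i \sum_j \sum_k \sum_l h i k * h j l * B i j * B k l.

Let D i m n (B : 'M[A]_(m, n)) := map_mx (d i) B.
(* [Gam i] is the connection matrix, with (l, j) entry Gamma^l_ij; [Rm i j] is
   the curvature endomorphism R(d_i, d_j), and [RmUp i j] and [Rc] have their
   last index raised. *)
Let Gam i : 'M[A]_N := \matrix_(l, j) rchristoffel l i j.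
Let Rm i j := D i (Gam j) - D j (Gam i) + (Gam i *m Gam j - Gam j *m Gam i).
Let RmUp i j := Rm i j *m h.
Let Rc := rricci *m h.

(** * Entrywise derivations of matrices *)

Lemma addmxE m n (B B' : 'M[A]_(m, n)) i j : (B + B') i j = B i j + B' i j.
Proof. by rewrite mxE. Qed.

Lemma oppmxE m n (B : 'M[A]_(m, n)) i j : (- B) i j = - B i j.
Proof. by rewrite mxE. Qed.

Lemma trmx_add m n (B B' : 'M[A]_(m, n)) : (B + B')^T = B^T + B'^T.
Proof. exact: linearD. Qed.

Lemma trmx_opp m n (B : 'M[A]_(m, n)) : (- B)^T = - B^T.
Proof. exact: linearN. Qed.

Let lin := (addmxE, oppmxE).

Lemma derivmxD i m n (B B' : 'M[A]_(m, n)) : D i (B + B') = D i B + D i B'.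
Proof. exact: raddfD. Qed.

Lemma derivmxN i m n (B : 'M[A]_(m, n)) : D i (- B) = - D i B.
Proof. exact: raddfN. Qed.

Lemma derivmxM i m n p (B : 'M[A]_(m, n)) (B' : 'M[A]_(n, p)) :
  D i (B *m B') = D i B *m B' + B *m D i B'.
Proof.
apply/matrixP => a b; rewrite !mxE raddf_sum -big_split /=.
by apply: eq_bigr => k _; rewrite !mxE dM.
Qed.

Lemma derivmx_tr i m n (B : 'M[A]_(m, n)) : D i B^T = (D i B)^T.
Proof. by rewrite /D map_trmx. Qed.

Lemma derivmxC i j m n (B : 'M[A]_(m, n)) : D i (D j B) = D j (D i B).
Proof. by apply/matrixP => a b; rewrite !mxE dC. Qed.

Lemma derivation1 i : d i 1 = 0.
Proof.
have := dM i 1 1; rewrite !mulr1 mul1r => /esym/eqP.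
by rewrite -subr_eq0 addrK => /eqP.
Qed.

Lemma derivmx1 i : D i (1%:M : 'M[A]_N) = 0.
Proof.
apply/matrixP => a b; rewrite !mxE; case: (a == b) => /=; first exact: derivation1.
exact: raddf0.
Qed.

(** * The Levi-Civita connection *)

Lemma inverse_metric_sym : h^T = h.
Proof.
rewrite -[LHS]mulmx1 -hK mulmxA -{1}g_sym -trmx_mul hK trmx1.
by rewrite mul1mx.
Qed.

Lemma rchristoffelC k i j : rchristoffel k i j = rchristoffel k j i.
Proof.
rewrite /rchristoffel; congr (_ * _); apply: eq_bigr => l _.
by rewrite -[in d l (g i j)]g_sym mxE [d j _ + _]addrC.
Qed.

Lemma metric_mul_christoffel i : g *m Gam i =
  half *: \matrix_(j, k) (d i (g k j) + d k (g i j) - d j (g i k)).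
Proof.
have -> : Gam i = half *:
    (h *m \matrix_(j, k) (d i (g k j) + d k (g i j) - d j (g i k))).
  apply/matrixP => a b; rewrite !mxE; congr (_ * _).
  by apply: eq_bigr => l _; rewrite mxE.
by rewrite -scalemxAr mulmxA hK mul1mx.
Qed.

(** Lowering the index cancels the inverse metric. The last two terms of the lowered symbol form a
    skew matrix, which drops out on adding the transpose; the first is symmetric and doubles. *)
Lemma metric_compatible i : D i g = (Gam i)^T *m g + g *m Gam i.
Proof.
have -> : (Gam i)^T *m g = (g *m Gam i)^T by rewrite trmx_mul g_sym.
rewrite metric_mul_christoffel; apply/matrixP => a b; rewrite !mxE.
have gE x y : g x y = g y x by rewrite -[in LHS]g_sym mxE.
rewrite (gE b a) (gE i b) (gE i a); set u := d i _.
by transitivity (half * 2 * u); [rewrite halfK mul1r | ring].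
Qed.

(** Differentiate [g *m h = 1%:M] and multiply by [h] on the left. *)
Lemma derivmx_inverse_metric i : D i h = - (Gam i *m h + h *m (Gam i)^T).
Proof.
have /(congr1 (mulmx h)) : D i g *m h + g *m D i h = 0.
  by rewrite -derivmxM hK derivmx1.
rewrite mulmx0 mulmxDr (mulmxA h g) gK mul1mx metric_compatible mulmxDl mulmxDr.
rewrite -(mulmxA _ g h) hK mulmx1 -(mulmxA g) (mulmxA h g) gK mul1mx.
by rewrite addrC [h *m _ + _]addrC => /eqP; rewrite addr_eq0 => /eqP.
Qed.

(** * Curvature symmetries and the second Bianchi identity *)

Lemma RmUp_swap i j : RmUp j i = - RmUp i j.
Proof.
rewrite /RmUp -mulNmx; congr (_ *m _); rewrite /Rm.
by apply/matrixP => a b; rewrite !lin; ring.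
Qed.

(** Commuting [d i] and [d j] on [h], whose derivatives come from metric compatibility, leaves
    [Rm i j *m h + h *m (Rm i j)^T = 0]. *)
Lemma RmUp_skew i j : (RmUp i j)^T = - RmUp i j.
Proof.
have := derivmxC i j h; rewrite !derivmx_inverse_metric !derivmxN
  !derivmxD !derivmxM !derivmx_inverse_metric !derivmx_tr /RmUp /Rm.
rewrite !(trmx_mul, trmx_add, trmx_opp) inverse_metric_sym
  !(mulmxDl, mulmxDr, mulNmx, mulmxN, mulmxA).
move=> /matrixP H.
apply/matrixP => a b; move/(_ a b): H; rewrite !lin => /eqP.
rewrite -subr_eq0 => /eqP H; apply/eqP; rewrite -subr_eq0 -oppr_eq0 -H.
by apply/eqP; ring.
Qed.

(* The last two indices of [RmUp i j] are corrected by the connection, but i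
   and j are not: the missing terms cancel in the cyclic sum. *)
Let covRm k i j := D k (RmUp i j) + Gam k *m RmUp i j + RmUp i j *m (Gam k)^T.

(* The Jacobi identity for the operators [d i + Gam i]. *)
Lemma second_bianchi_Rm k i j :
  D k (Rm i j) + (Gam k *m Rm i j - Rm i j *m Gam k) +
  (D i (Rm j k) + (Gam i *m Rm j k - Rm j k *m Gam i)) +
  (D j (Rm k i) + (Gam j *m Rm k i - Rm k i *m Gam j)) = 0.
Proof.
rewrite /Rm !(derivmxD, derivmxN, derivmxM) !(mulmxDl, mulmxDr, mulNmx, mulmxN, mulmxA).
rewrite (derivmxC k i (Gam j)) (derivmxC j k (Gam i)) (derivmxC i j (Gam k)).
by apply/matrixP => a b; rewrite !lin [RHS]mxE; ring.
Qed.

Lemma covRmE k i j : covRm k i j =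
  (D k (Rm i j) + (Gam k *m Rm i j - Rm i j *m Gam k)) *m h.
Proof.
rewrite /covRm /RmUp derivmxM derivmx_inverse_metric
  !(mulmxDl, mulmxDr, mulNmx, mulmxN, mulmxA).
by apply/matrixP => a b; rewrite !lin; ring.
Qed.

Lemma second_bianchi k i j : covRm k i j + covRm i j k + covRm j k i = 0.
Proof. by rewrite !covRmE -!mulmxDl second_bianchi_Rm mul0mx. Qed.

Lemma covRm_swap k i j : covRm k j i = - covRm k i j.
Proof. by rewrite /covRm RmUp_swap derivmxN mulmxN mulNmx !opprD. Qed.

Lemma covRm_skew k i j : (covRm k i j)^T = - covRm k i j.
Proof.
rewrite /covRm !trmx_add (trmx_mul (Gam k)) (trmx_mul (RmUp i j)) trmxK -derivmx_tr
  RmUp_skew derivmxN mulmxN mulNmx !opprD.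
by rewrite addrAC.
Qed.

(** * Contractions of the curvature *)

Lemma RmE i j l k : Rm i j l k = rriem l i j k.
Proof.
rewrite /Rm /rriem !lin !mxE -sumrB; congr (_ + _).
by apply: eq_bigr => m _; rewrite !mxE.
Qed.

Lemma RcE j k : Rc j k = \sum_i RmUp i j i k.
Proof.
rewrite /Rc /RmUp mxE; under [RHS]eq_bigr do rewrite mxE.
rewrite exchange_big /=; apply: eq_bigr => m _.
rewrite mxE big_distrl /=; apply: eq_bigr => i _.
by rewrite RmE.
Qed.

Lemma rscal_trace : rscal = \tr Rc.
Proof.
rewrite /rscal /Rc /mxtrace; under [RHS]eq_bigr do rewrite mxE.
apply: eq_bigr => i _; apply: eq_bigr => j _.
by rewrite -[in LHS]inverse_metric_sym mxE mulrC.
Qed.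

(** The divergence of Ricci: the two Christoffel sums correct the raised and the lowered index of
    [Rc]. *)
Definition divRc j : A :=
  \sum_k d k (Rc j k) + \sum_k \sum_m Rc j m * rchristoffel k k m
  - \sum_k \sum_m Rc k m * rchristoffel k j m.

Lemma covRm_entry k i j a b :
  covRm k i j a b = d k (RmUp i j a b) + \sum_m rchristoffel a k m * RmUp i j m b
                + \sum_m RmUp i j a m * rchristoffel b k m.
Proof.
rewrite /covRm !addmxE; congr (_ + _ + _); rewrite !mxE //.
  by apply: eq_bigr => m _; rewrite mxE.
by apply: eq_bigr => m _; rewrite !mxE.
Qed.

Lemma RmUp_skewE i j a b : RmUp i j a b = - RmUp i j b a.
Proof. by rewrite -oppmxE -RmUp_skew [RHS]mxE. Qed.

Lemma sum_skew (F : 'I_N -> 'I_N -> A) :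
  (forall k m, F k m = - F m k) -> \sum_k \sum_m F k m = 0.
Proof.
move=> F_skew; set x := LHS.
have xN : x = - x.
  rewrite {2}/x exchange_big /= -sumrN; apply: eq_bigr => k _.
  by rewrite -sumrN; apply: eq_bigr => m _.
rewrite -[x]mul1r -halfK -mulrA mulr_natl mulr2n {1}xN.
by rewrite addNr mulr0.
Qed.

(** The correction at the first upper index vanishes, as it contracts the symmetric
    [rchristoffel i k m] with the skew [RmUp i j m k]. What remains is [divRc j] without its last
    sum. *)
Lemma trace_covRm_div j : \sum_i \sum_k covRm k i j i k =
  \sum_k d k (Rc j k) + \sum_k \sum_m Rc j m * rchristoffel k k m.
Proof.
under eq_bigr do under eq_bigr do rewrite covRm_entry.
under eq_bigr do rewrite !big_split /=.
rewrite !big_split /= [X in _ + X + _]big1 ?addr0; last first.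
  move=> i _; apply: sum_skew => k m.
  by rewrite rchristoffelC (RmUp_skewE _ _ m) mulrN.
congr (_ + _); rewrite exchange_big /=; apply: eq_bigr => k _.
  by rewrite RcE raddf_sum.
rewrite exchange_big /=; apply: eq_bigr => m _.
by rewrite RcE big_distrl.
Qed.

(** The two upper indices contribute equal Christoffel sums, together exactly what [divRc j * 2]
    subtracts. *)
Lemma trace_covRm_scal j : \sum_i \sum_k covRm j i k i k =
  d j rscal + (\sum_k \sum_m Rc k m * rchristoffel k j m) * 2.
Proof.
under eq_bigr do under eq_bigr do rewrite covRm_entry.
under eq_bigr do rewrite !big_split /=.
rewrite !big_split /= -addrA mulr_natr mulr2n; congr (_ + (_ + _)).
- rewrite rscal_trace /mxtrace raddf_sum /= exchange_big /=.
  by apply: eq_bigr => k _; rewrite RcE raddf_sum.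
- apply: eq_bigr => i _; rewrite exchange_big /=; apply: eq_bigr => m _.
  rewrite RcE big_distrl /=; apply: eq_bigr => k _.
  by rewrite RmUp_skewE RmUp_swap oppmxE opprK mulrC.
- rewrite exchange_big /=; apply: eq_bigr => k _.
  rewrite exchange_big /=; apply: eq_bigr => m _.
  by rewrite RcE big_distrl.
Qed.

(* Contracting the second Bianchi identity twice makes two of its three terms
   equal to the divergence of Ricci and the third one to minus d R. *)
Lemma contracted_bianchi j : divRc j * 2 = d j rscal.
Proof.
(* Exchanging [i] and [k] costs one sign in the lower pair and one in the upper pair. *)
have sum_swap : \sum_i \sum_k covRm i j k i k = \sum_i \sum_k covRm k i j i k.
  rewrite exchange_big /=; apply: eq_bigr => k _; apply: eq_bigr => i _.
  by rewrite covRm_swap -covRm_skew mxE.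
have : \sum_i \sum_k (covRm k i j + covRm i j k + covRm j k i) i k = 0.
  by rewrite big1 // => i _; rewrite big1 // => k _; rewrite second_bianchi mxE.
under eq_bigr do under eq_bigr do
  rewrite (addmxE (_ + _)) addmxE (covRm_swap j) oppmxE.
under eq_bigr do rewrite !big_split /=.
rewrite !big_split /= sum_swap trace_covRm_div.
under [X in _ + X]eq_bigr do rewrite sumrN.
rewrite sumrN trace_covRm_scal /divRc => /eqP; rewrite subr_eq0 => /eqP H.
by apply/eqP; rewrite mulrBl subr_eq -H; apply/eqP; ring.
Qed.

(** * Consequences of the soliton equation *)

Hypothesis soliton : rricci + rhess = g.

Let dphi : 'rV[A]_N := \row_j d j phi.

(** Read off from [soliton]: the Hessian is symmetric because derivations commute and Christoffel
    symbols are symmetric in their lower indices. *)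
Lemma rricci_sym : rricci^T = rricci.
Proof.
have -> : rricci = g - rhess by rewrite -soliton addrK.
rewrite trmx_add trmx_opp g_sym; congr (_ - _).
apply/matrixP => a b; rewrite !mxE dC; congr (_ - _).
by apply: eq_bigr => k _; rewrite rchristoffelC.
Qed.

Lemma derivmx_dphi i : D i dphi = dphi *m Gam i + row i (g - rricci).
Proof.
rewrite -soliton addrAC subrr add0r; apply/matrixP => a b; rewrite !mxE.
rewrite addrC -addrA -[LHS]addr0; congr (_ + _); apply/eqP.
rewrite eq_sym addrC subr_eq0; apply/eqP; apply: eq_bigr => k _.
by rewrite !mxE rchristoffelC mulrC rchristoffelC.
Qed.

(* On a soliton the covariant derivative of d(phi) in the direction i is the
   row i of g - Ric, so that commuting two covariant derivatives expresses the
   curvature through the derivatives of Ric. *)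
Lemma ricci_identity i j :
  dphi *m Rm i j = D j (row i (g - rricci)) + row j (g - rricci) *m Gam i
               - (D i (row j (g - rricci)) + row i (g - rricci) *m Gam j).
Proof.
have := derivmxC i j dphi; rewrite !derivmx_dphi !derivmxD !derivmxM !derivmx_dphi.
move: (row i _) (row j _) => e e'.
rewrite /Rm !(mulmxDl, mulmxDr, mulNmx, mulmxN, mulmxA) => /matrixP H.
apply/matrixP => a b; move/(_ a b): H; rewrite !lin => /eqP.
rewrite -subr_eq0 => /eqP H; apply/eqP; rewrite -subr_eq0 -H.
by apply/eqP; ring.
Qed.

Lemma row_raised i : row i (g - rricci) *m h = row i (1%:M) - row i Rc.
Proof. by rewrite -row_mul mulmxBl hK linearB. Qed.

Lemma derivmx_row1 i j : D i (row j (1%:M : 'M[A]_N)) = 0.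
Proof. by have := derivmx1 i; rewrite /D map_row => ->; rewrite row0. Qed.

(** Raising the index turns [g - rricci] into [1%:M - Rc]. The identity part has zero derivative,
    and the Christoffel terms it leaves cancel by symmetry in the lower indices. *)
Lemma ricci_identity_raised i j :
  dphi *m RmUp i j = D i (row j Rc) + row j Rc *m (Gam i)^T
               - (D j (row i Rc) + row i Rc *m (Gam j)^T).
Proof.
have De k l : D k (row l (g - rricci)) *m h = - D k (row l Rc)
    + row l (g - rricci) *m Gam k *m h + row k (Gam l)^T - row l Rc *m (Gam k)^T.
  have := congr1 (@D k _ _) (row_raised l); rewrite derivmxM derivmx_inverse_metric derivmxD
    derivmxN derivmx_row1 add0r => /eqP.
  rewrite mulmxN subr_eq => /eqP ->.
  rewrite mulmxDr !mulmxA row_raised mulmxBl -(row_mul l 1%:M) mul1mx addrA addrA.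
  congr (_ + _ + _ - _).
  by apply/matrixP => a b; rewrite !mxE rchristoffelC.
rewrite mulmxA ricci_identity mulmxBl !mulmxDl !De.
have -> : row i (Gam j)^T = row j (Gam i)^T
  by apply/matrixP => a b; rewrite !mxE rchristoffelC.
by apply/matrixP => a b; rewrite !lin; ring.
Qed.

Lemma cov_row_Rc i j a :
  (D i (row j Rc) + row j Rc *m (Gam i)^T) 0 a
  = d i (Rc j a) + \sum_m Rc j m * rchristoffel a i m.
Proof.
rewrite addmxE; congr (_ + _); first by rewrite mxE mxE.
rewrite mxE; apply: eq_bigr => m _; rewrite [(_)^T _ _]mxE [Gam i _ _]mxE; congr (_ * _).
by rewrite [LHS]mxE.
Qed.

Lemma deriv_rscal j : d j rscal = (\sum_a Rc j a * dphi 0 a) * 2.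
Proof.
have divE : divRc j - d j rscal = - \sum_a Rc j a * dphi 0 a.
  transitivity (\sum_i (dphi *m RmUp i j) 0 i).
    under eq_bigr do rewrite ricci_identity_raised addmxE oppmxE !cov_row_Rc.
    rewrite sumrB !big_split /= /divRc rscal_trace /mxtrace (raddf_sum (d j)) /=.
    by rewrite opprD addrA [RHS]addrAC.
  under eq_bigr do rewrite mxE.
  rewrite exchange_big /= -sumrN; apply: eq_bigr => a _.
  rewrite RcE big_distrl /= -sumrN; apply: eq_bigr => i _.
  by rewrite RmUp_skewE mulrN mulrC.
move/(congr1 (fun x => x * 2)): divE; rewrite mulrBl contracted_bianchi => H.
have -> : d j rscal = - (d j rscal - d j rscal * 2) by ring.
by rewrite H mulNr opprK.
Qed.

(** * The Laplacian of the scalar curvature *)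

Lemma rgradE f : rgrad f = (\row_j d j f) *m h.
Proof.
apply/matrixP => a b; rewrite !mxE; apply: eq_bigr => j _.
by rewrite mxE mulrC -[in LHS]inverse_metric_sym mxE.
Qed.

Lemma rgrad_rscal : rgrad rscal = (rgrad phi *m Rc) *+ 2.
Proof.
have -> : rgrad rscal = (dphi *m Rc^T) *+ 2 *m h.
  rewrite rgradE; congr (_ *m _); apply/matrixP => a b.
  rewrite mulmxnE 2!mxE deriv_rscal mulr_natr; congr (_ *+ 2).
  by apply: eq_bigr => k _; rewrite [Rc^T _ _]mxE mulrC ord1.
by rewrite mulr2n mulmxDl -mulr2n rgradE /Rc trmx_mul inverse_metric_sym rricci_sym !mulmxA.
Qed.

(** The soliton equation with one index raised: the covariant derivative of the gradient is the
    identity minus [Rc]. *)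
Lemma derivmx_rgrad i : D i (rgrad phi) =
  row i (1%:M) - row i Rc - rgrad phi *m (Gam i)^T.
Proof.
rewrite rgradE derivmxM derivmx_dphi derivmx_inverse_metric mulmxN mulmxDl mulmxDr
  row_raised !mulmxA.
by apply/matrixP => a b; rewrite !lin; ring.
Qed.

Lemma rnorm2E : rnorm2 rricci = \tr (Rc *m Rc).
Proof.
have PE a b : Rc a b = \sum_j rricci a j * h j b by rewrite mxE.
have hE a b : h a b = h b a by rewrite -[in LHS]inverse_metric_sym mxE.
rewrite /rnorm2 /mxtrace; apply: eq_bigr => i _.
rewrite [RHS]mxE; under [RHS]eq_bigr do rewrite !PE big_distrl /=.
under [LHS]eq_bigr do rewrite exchange_big /=.
rewrite exchange_big; apply: eq_bigr => l _; apply: eq_bigr => j _ /=.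
rewrite big_distrr; apply: eq_bigr => k _ /=.
have -> : rricci k l = rricci l k by rewrite -[in LHS]rricci_sym [LHS]mxE.
rewrite (hE i k); ring.
Qed.

(** This is twice the divergence of [rgrad phi *m Rc]. Where the derivative hits the gradient, the
    trace of [(1%:M - Rc) *m Rc] gives R - |Ric|^2; where it hits [Rc], the gradient pairs with
    [divRc], which is half of dR and so Ric(grad phi). *)
Theorem rlap_rscal_soliton :
  rlap rscal = 2 * rscal - 2 * rnorm2 rricci +
    2 * (rgrad phi *m rricci *m (rgrad phi)^T) 0 0.
Proof.
set u := rgrad phi.
have lapE : rlap rscal = 2 *
  \sum_i (D i (u *m Rc) 0 i + \sum_k rchristoffel i i k * (u *m Rc) 0 k).
  rewrite /rlap rgrad_rscal -/u big_distrr; apply: eq_bigr => i _ /=.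
  rewrite mulrDr big_distrr; congr (_ + _).
    by rewrite mulmxnE raddfMn [in RHS]mxE mulr_natl.
  by apply: eq_bigr => k _ /=; rewrite mulmxnE mulrnAr mulr_natl.
have uP : (u *m rricci *m u^T) 0 0 = \sum_j u 0 j * \sum_a Rc j a * dphi 0 a.
  have -> : u *m rricci *m u^T = u *m (Rc *m dphi^T).
    by rewrite {2}/u rgradE trmx_mul inverse_metric_sym !mulmxA.
  rewrite mxE; apply: eq_bigr => j _; congr (_ * _).
  by rewrite mxE; apply: eq_bigr => a _; rewrite [dphi^T _ _]mxE.
have divE : 2 * \sum_j u 0 j * \sum_a Rc j a * dphi 0 a = 2 * \sum_j u 0 j * divRc j.
  rewrite !big_distrr; apply: eq_bigr => j _ /=.
  rewrite !(mulrCA 2); congr (_ * _).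
  by rewrite mulrC -deriv_rscal -contracted_bianchi mulrC.
rewrite lapE uP divE rscal_trace rnorm2E -mulrBr -mulrDr; congr (_ * _).
have -> : \sum_i (D i (u *m Rc) 0 i + \sum_k rchristoffel i i k * (u *m Rc) 0 k) =
  \sum_i (Rc i i - (Rc *m Rc) i i + \sum_j u 0 j *
    (d i (Rc j i) + \sum_k Rc j k * rchristoffel i i k - \sum_k Rc k i * rchristoffel k j i)).
  apply: eq_bigr => i _.
  rewrite derivmxM addmxE derivmx_rgrad mulmxDl mulmxDl !mulNmx
    !addmxE !oppmxE -!row_mul mul1mx.
  have -> : row i Rc 0 i = Rc i i by rewrite mxE.
  have -> : row i (Rc *m Rc) 0 i = (Rc *m Rc) i i by rewrite mxE.
  rewrite -!addrA; congr (_ + (_ + _)).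
  have -> : (u *m D i Rc) 0 i = \sum_j u 0 j * d i (Rc j i).
    by rewrite mxE; apply: eq_bigr => j _; rewrite [D i Rc _ _]mxE.
  have -> : \sum_k rchristoffel i i k * (u *m Rc) 0 k
      = \sum_j u 0 j * \sum_k Rc j k * rchristoffel i i k.
    under [RHS]eq_bigr do rewrite big_distrr /=.
    rewrite exchange_big /=; apply: eq_bigr => k _.
    by rewrite mxE big_distrr; apply: eq_bigr => j _ /=; ring.
  have -> : (u *m (Gam i)^T *m Rc) 0 i = \sum_j u 0 j * \sum_k Rc k i * rchristoffel k j i.
    under [RHS]eq_bigr do rewrite big_distrr /=.
    rewrite exchange_big mxE; apply: eq_bigr => k _ /=.
    rewrite mxE big_distrl; apply: eq_bigr => j _ /=.
    by rewrite [(_)^T _ _]mxE [Gam i _ _]mxE rchristoffelC; ring.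
  rewrite addrC -big_split -sumrB /=; apply: eq_bigr => j _.
  by rewrite mulrBr mulrDr.
rewrite big_split sumrB /=; congr (_ + _).
rewrite exchange_big; apply: eq_bigr => j _ /=; rewrite -big_distrr.
by congr (_ * _); rewrite sumrB big_split /divRc /=; congr (_ - _); rewrite exchange_big.
Qed.

End TensorCalculus.

(** * Mean values of second differences *)

Section Line.
Variables (R : realType) (V : normedModType R).
Implicit Types (f : V -> R) (a v w : V).

Lemma is_derive_line f a v (u : R) : derivable f (a + u *: v) v ->
  is_derive u 1 (fun t : R => f (a + t *: v)) ('D_v f (a + u *: v)).
Proof.
move=> df; suff E : (fun h : R => h^-1 *: (((fun t : R => f (a + t *: v)) \o shift u) (h *: 1)
      - f (a + u *: v)))
    = (fun h : R => h^-1 *: ((f \o shift (a + u *: v)) (h *: v) - f (a + u *: v))).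
  by split; rewrite /derivable /derive E.
apply/funext => h /=; congr (_ *: (f _ - _)).
by rewrite scalerDl [h *: 1]mulr1 addrCA.
Qed.

(** The mean value theorem twice: along [v] for the difference of [f] between two parallel sides,
    then along [w] for ['D_v f]. *)
Lemma second_difference f a v w (s : R) : 0 < s ->
  (forall u t, 0 <= u <= s -> 0 <= t <= s ->
     derivable f (a + t *: w + u *: v) v /\
     derivable ('D_v f) (a + u *: v + t *: w) w) ->
  exists u t, [/\ 0 <= u <= s, 0 <= t <= s &
    f (a + s *: w + s *: v) - f (a + s *: v) - (f (a + s *: w) - f a)
    = 'D_w ('D_v f) (a + u *: v + t *: w) * s ^+ 2].
Proof.
move=> s0 df.
have s_itv : 0 <= s <= s by rewrite ltW /=.
have o_itv : 0 <= (0 : R) <= s by rewrite lexx ltW.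
pose phi u := f (a + s *: w + u *: v) - f (a + u *: v).
have dphi u : 0 <= u <= s ->
    is_derive u 1 phi ('D_v f (a + s *: w + u *: v) - 'D_v f (a + u *: v)).
  move=> us; apply: is_deriveB; apply: is_derive_line.
    exact: (df _ _ us s_itv).1.
  by have [+ _] := df _ _ us o_itv; rewrite scale0r addr0.
have [u||u us E] := MVT_segment (f := phi)
    (df := fun u => 'D_v f (a + s *: w + u *: v) - 'D_v f (a + u *: v)) (ltW s0).
- by rewrite in_itv /= => /andP[/ltW u0 /ltW us]; apply: dphi; rewrite u0.
- apply: derivable_within_continuous => u; rewrite in_itv => us.
  by have [] := dphi u us.
rewrite in_itv /= in us.
pose psi t := 'D_v f (a + u *: v + t *: w).
have dpsi t : 0 <= t <= s -> is_derive t 1 psi ('D_w ('D_v f) (a + u *: v + t *: w)).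
  by move=> ts; apply: is_derive_line; have [] := df _ _ us ts.
have [t||t ts E'] := MVT_segment (f := psi)
    (df := fun t => 'D_w ('D_v f) (a + u *: v + t *: w)) (ltW s0).
- by rewrite in_itv /= => /andP[/ltW t0 /ltW ts]; apply: dpsi; rewrite t0.
- apply: derivable_within_continuous => t; rewrite in_itv => ts.
  by have [] := dpsi t ts.
rewrite in_itv /= in ts.
exists u, t; split=> //.
move: E E'; rewrite /phi /psi !scale0r !addr0 subr0 => E E'.
by rewrite E [a + s *: w + _]addrAC E' expr2 mulrA.
Qed.

End Line.

(** * Functions of class C^k on an open set, and Schwarz's theorem *)

Section CkTheory.
Variables (R : realType) (N : nat) (U : set 'rV[R]_N).
Hypothesis oU : open U.
Implicit Types (f h : 'rV[R]_N -> R).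

Lemma near_open x (P : 'rV[R]_N -> Prop) :
  U x -> (forall y, U y -> P y) -> \forall y \near x, P y.
Proof.
move=> Ux UP; have : nbhs x U by exact: open_nbhs_nbhs.
by apply: filterS.
Qed.

Lemma near_eqU f h x : {in U, f =1 h} -> U x -> {near x, f =1 h}.
Proof. by move=> fh Ux; apply: (near_open Ux) => y Uy; apply: fh; rewrite inE. Qed.

Lemma eq_partial i f h : {in U, f =1 h} -> {in U, partial i f =1 partial i h}.
Proof. by move=> fh x /set_mem Ux; apply: near_eq_derive; apply: near_eqU. Qed.

Lemma eq_continuousU f h x : {in U, f =1 h} -> U x ->
  {for x, continuous f} -> {for x, continuous h}.
Proof.
move=> fh Ux; rewrite /prop_for /continuous_at -fh ?inE//.
move=> cf; apply: cvg_trans cf; exact: (near_eq_cvg (near_eqU fh Ux)).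
Qed.

(** A derivative at a point of the open set [U] sees only values on [U]. The closure lemmas can thus
    replace a partial derivative by its Leibniz formula, known only on [U]. *)
Lemma eq_Ck k f h : {in U, f =1 h} -> Ck_on k U f -> Ck_on k U h.
Proof.
elim: k f h => [|k IHk] f h fh [cf df]; (split; first by
  move=> x Ux; apply: eq_continuousU fh Ux (cf x Ux)) => // i.
have [dfi Cfi] := df i; split; last exact: IHk (eq_partial i fh) Cfi.
by move=> x Ux; apply: near_eq_derivable (dfi x Ux); apply: near_eqU.
Qed.

Lemma CkW k f : Ck_on k.+1 U f -> Ck_on k U f.
Proof.
elim: k f => [|k IHk] f [cf df]; split=> // i.
by have [dfi Cfi] := df i; split=> //; apply: IHk.
Qed.

Lemma smooth_partial i f : smooth_on U f -> smooth_on U (partial i f).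
Proof. by move=> sf k; have [_ /(_ i) []] := sf k.+1. Qed.

Lemma smooth_derivable i f x : smooth_on U f -> U x ->
  derivable f x (delta_mx 0 i).
Proof. by move=> sf Ux; have [_ /(_ i) [/(_ x Ux)]] := sf 1%N. Qed.

Lemma Ck_cst k (a : R) : Ck_on k U (fun=> a).
Proof.
elim: k a => [|k IHk] a; (split; first by move=> x _; apply: cst_continuous) => // i.
split; first by move=> x _; apply: derivable_cst.
by apply: eq_Ck (IHk 0) => x _; rewrite /partial derive_cst.
Qed.

Lemma CkD k f h : Ck_on k U f -> Ck_on k U h -> Ck_on k U (fun x => f x + h x).
Proof.
elim: k f h => [|k IHk] f h [cf df] [ch dh]; (split; first by
  move=> x Ux; apply: continuousD; [apply: cf | apply: ch]) => // i.
have [dfi Cfi] := df i; have [dhi Chi] := dh i.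
split; first by move=> x Ux; apply: derivableD; [apply: dfi | apply: dhi].
apply: eq_Ck (IHk _ _ Cfi Chi) => x /set_mem Ux.
by rewrite /partial deriveD//; [apply: dfi | apply: dhi].
Qed.

Lemma CkM k f h : Ck_on k U f -> Ck_on k U h -> Ck_on k U (fun x => f x * h x).
Proof.
elim: k f h => [|k IHk] f h Cf Ch; move: (Cf) (Ch) => [cf df] [ch dh];
  (split; first by
  move=> x Ux; apply: continuousM; [apply: cf | apply: ch]) => // i.
have [dfi Cfi] := df i; have [dhi Chi] := dh i.
split; first by move=> x Ux; apply: derivableM; [apply: dfi | apply: dhi].
apply: eq_Ck (CkD (IHk _ _ (CkW Cf) Chi) (IHk _ _ (CkW Ch) Cfi)) => x /set_mem Ux.
by rewrite /partial deriveM//; [apply: dfi | apply: dhi].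
Qed.

Lemma CkN k f : Ck_on k U f -> Ck_on k U (fun x => - f x).
Proof.
move=> Cf; apply: eq_Ck (CkM (Ck_cst k (-1)) Cf) => x _.
by rewrite mulN1r.
Qed.

Lemma CkV k f : (forall x, U x -> f x != 0) ->
  Ck_on k U f -> Ck_on k U (fun x => (f x)^-1).
Proof.
move=> f0; elim: k => [|k IHk] Cf; move: (Cf) => [cf df];
  (split; first by
  move=> x Ux; apply: continuousV; [apply: f0 | apply: cf]) => // i.
have [dfi Cfi] := df i.
split; first by move=> x Ux; apply: derivableV; [apply: f0 | apply: dfi].
have CV := IHk (CkW Cf).
apply: eq_Ck (CkN (CkM (CkM CV CV) Cfi)) => x /set_mem Ux.
rewrite /partial deriveV ?f0//; last exact: dfi.
by rewrite -mulNr -expr2 exprVn.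
Qed.

Lemma schwarz i j f x : smooth_on U f -> U x ->
  partial i (partial j f) x = partial j (partial i f) x.
Proof.
move=> sf Ux.
have dU k h y : smooth_on U h -> U y -> derivable h y (delta_mx 0 k).
  exact: smooth_derivable.
have spf k := smooth_partial k sf.
have cU h : smooth_on U h -> {for x, continuous h} by move=> /(_ 0%N) [] /(_ x Ux).
have cij := cU _ (smooth_partial i (spf j)).
have cji := cU _ (smooth_partial j (spf i)).
(* Both mixed partials approximate the same second difference quotient over a
   small square of side s with corner x. *)
apply/eqP; rewrite -subr_eq0 -normr_le0; apply/ler_addgt0Pl => e e0.
rewrite addr0 [e]splitr.
have e20 : 0 < e / 2 by rewrite divr_gt0.
have [r /= r0 xr] : exists2 r, 0 < r & forall y, `|x - y| < r ->
    [/\ U y, `|partial i (partial j f) x - partial i (partial j f) y| < e / 2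
     & `|partial j (partial i f) x - partial j (partial i f) y| < e / 2].
  have : \forall y \near x, [/\ U y,
      `|partial i (partial j f) x - partial i (partial j f) y| < e / 2
     & `|partial j (partial i f) x - partial j (partial i f) y| < e / 2].
    have nU : nbhs x U by exact: open_nbhs_nbhs.
    have /cvgrPdist_lt/(_ _ e20) n1 := cij.
    have /cvgrPdist_lt/(_ _ e20) n2 := cji.
    by near=> y; split; [exact: (near nU y) | exact: (near n1 y) | exact: (near n2 y)].
  by move=> /nbhs_normP [r r0 xr]; exists r => // y; apply: xr.
(* The summand 1 leaves a spare [s] beyond the two sides, so that the closed square lies strictly
   inside the ball of radius [r]. *)
pose c := `|delta_mx 0 i : 'rV[R]_N| + `|delta_mx 0 j : 'rV[R]_N| + 1.
have c0 : 0 < c by rewrite ltr_wpDl// addr_ge0.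
pose s := r / c.
have s0 : 0 < s by rewrite divr_gt0.
have box k l u v : (k, l) = (i, j) \/ (k, l) = (j, i) ->
    0 <= u <= s -> 0 <= v <= s ->
    `|x - (x + u *: delta_mx 0 k + v *: delta_mx 0 l)| < r.
  move=> kl /andP[u0 us] /andP[v0 vs].
  rewrite -addrA opprD addrA subrr sub0r normrN.
  have lek (k' : 'I_N) : 0 <= `|delta_mx 0 k' : 'rV[R]_N| by [].
  rewrite (le_lt_trans (ler_normD _ _))// !normrZ !ger0_norm//.
  have -> : r = s * c by rewrite divfK// gt_eqF.
  have -> : s * c = s * `|delta_mx 0 k : 'rV[R]_N| + s * `|delta_mx 0 l : 'rV[R]_N| + s.
    by rewrite /c; case: kl => -[-> ->]; ring.
  by rewrite ltr_pwDr// lerD// ler_wpM2r.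
have [u [t [us ts E]]] : exists u t, [/\ 0 <= u <= s, 0 <= t <= s &
    f (x + s *: delta_mx 0 j + s *: delta_mx 0 i) - f (x + s *: delta_mx 0 i)
    - (f (x + s *: delta_mx 0 j) - f x)
    = partial j (partial i f) (x + u *: delta_mx 0 i + t *: delta_mx 0 j) * s ^+ 2].
  apply: (@second_difference _ _ f x (delta_mx 0 i) (delta_mx 0 j)) => [//|u t us ts]; split.
  - by apply: dU sf _; have [] := xr _ (box j i t u (or_intror erefl) ts us).
  - by apply: dU (spf i) _; have [] := xr _ (box i j u t (or_introl erefl) us ts).
have [u' [t' [us' ts' E']]] : exists u t, [/\ 0 <= u <= s, 0 <= t <= s &
    f (x + s *: delta_mx 0 i + s *: delta_mx 0 j) - f (x + s *: delta_mx 0 j)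
    - (f (x + s *: delta_mx 0 i) - f x)
    = partial i (partial j f) (x + u *: delta_mx 0 j + t *: delta_mx 0 i) * s ^+ 2].
  apply: (@second_difference _ _ f x (delta_mx 0 j) (delta_mx 0 i)) => [//|u' t' us' ts']; split.
  - by apply: dU sf _; have [] := xr _ (box i j t' u' (or_introl erefl) ts' us').
  - by apply: dU (spf j) _; have [] := xr _ (box j i u' t' (or_intror erefl) us' ts').
have [_ _ D] := xr _ (box i j u t (or_introl erefl) us ts).
have [_ D' _] := xr _ (box j i u' t' (or_intror erefl) us' ts').
move: E E' D D'; rewrite [x + s *: delta_mx 0 j + _]addrAC.
move: (partial j _ (_ + _)) (partial i _ (_ + _)) => a b E E' D D'.
have {E E'} ab : a = b.
  have s2 : s ^+ 2 != 0 by rewrite expf_neq0 // gt_eqF.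
  by apply: (mulIf s2); rewrite -E -E'; ring.
rewrite ab distrC in D.
by rewrite -(subrKA b) (le_trans (ler_normD _ _)) // lerD // ltW.
Unshelve. all: by end_near.
Qed.

End CkTheory.

(** * The differential ring of smooth functions on an open set *)

Section SmoothRing.
Variables (R : realType) (N : nat) (U : set 'rV[R]_N) (oU : open U).

Let T := {x | U x}.

(* Ring elements are functions on the subtype of [U] rather than functions on
   the whole space, so that equality in the ring is equality on [U]; [ext] lets
   them be differentiated. *)
Definition ext (a : T -> R) (x : 'rV[R]_N) : R :=
  if pselect (U x) is left Ux then a (exist _ x Ux) else 0.

Lemma extE a (x : T) : ext a (sval x) = a x.
Proof.
case: x => x Ux /=; rewrite /ext; case: pselect => // Ux'.
by rewrite (Prop_irrelevance Ux' Ux).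
Qed.

Lemma ext_in a x (Ux : U x) : ext a x = a (exist _ x Ux).
Proof. by rewrite -(extE a (exist _ x Ux)). Qed.

(* The unused argument is a tag from which canonical structures recover the
   openness of [U], without which the smooth functions need not form a ring. *)
Definition smooth_pred of open U : {pred T -> R} :=
  fun a => `[< smooth_on U (ext a) >].

Lemma smooth_predP (a : T -> R) : reflect (smooth_on U (ext a)) (a \in smooth_pred oU).
Proof. exact: asboolP. Qed.

Lemma smooth_pred_subring : subring_closed (smooth_pred oU).
Proof.
split=> [|a b /smooth_predP sa /smooth_predP sb|a b /smooth_predP sa /smooth_predP sb];
  apply/smooth_predP => k.
- apply: eq_Ck (Ck_cst oU k 1) => // x /set_mem Ux.
  by rewrite (ext_in _ Ux).
- apply: eq_Ck (CkD oU (sa k) (CkN oU (sb k))) => // x /set_mem Ux.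
  by rewrite !(ext_in _ Ux).
- apply: eq_Ck (CkM oU (sa k) (sb k)) => // x /set_mem Ux.
  by rewrite !(ext_in _ Ux).
Qed.

Record smooth_ring := SmoothRing {
  smooth_val :> T -> R;
  _ : smooth_val \in smooth_pred oU
}.

HB.instance Definition _ := [isSub for smooth_val].
HB.instance Definition _ := [Choice of smooth_ring by <:].
HB.instance Definition _ :=
  GRing.SubChoice_isSubComPzRing.Build _ _ smooth_ring smooth_pred_subring.

Lemma smooth_ringP (a : smooth_ring) : smooth_on U (ext a).
Proof. by apply/smooth_predP; exact: (valP a). Qed.

Lemma smooth_ring_eq (a b : smooth_ring) :
  {in U, ext a =1 ext b} -> a = b.
Proof.
move=> ab; apply/val_inj/funext => x /=.
by rewrite -!extE ab// inE; exact: svalP.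
Qed.

Lemma extD (a b : smooth_ring) x : ext (a + b) x = ext a x + ext b x.
Proof. by rewrite /ext; case: pselect => // _; rewrite addr0. Qed.

Lemma extN (a : smooth_ring) x : ext (- a) x = - ext a x.
Proof. by rewrite /ext; case: pselect => // _; rewrite oppr0. Qed.

Lemma extM (a b : smooth_ring) x : ext (a * b) x = ext a x * ext b x.
Proof. by rewrite /ext; case: pselect => // _; rewrite mulr0. Qed.

Lemma to_smooth_subproof (h : 'rV[R]_N -> R) : smooth_on U h ->
  (fun x : T => h (sval x)) \in smooth_pred oU.
Proof.
move=> sh; apply/smooth_predP => k; apply: eq_Ck (sh k) => // x /set_mem Ux.
by rewrite (ext_in _ Ux).
Qed.

Definition to_smooth (h : 'rV[R]_N -> R) (sh : smooth_on U h) : smooth_ring :=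
  SmoothRing (to_smooth_subproof sh).

Lemma to_smoothE h sh x : U x -> ext (@to_smooth h sh) x = h x.
Proof. by move=> Ux; rewrite (ext_in _ Ux). Qed.

(* Kept opaque: unfolding iterated derivatives makes unification diverge. *)
Lemma pderiv_subproof (i : 'I_N) (a : smooth_ring) :
  {b : smooth_ring | forall x, U x -> ext b x = partial i (ext a) x}.
Proof.
exists (to_smooth (smooth_partial i (smooth_ringP a))) => x; exact: to_smoothE.
Qed.

Definition pderiv i a : smooth_ring := sval (pderiv_subproof i a).

Lemma pderivE i a x : U x -> ext (pderiv i a) x = partial i (ext a) x.
Proof. exact: svalP (pderiv_subproof i a) x. Qed.

Lemma pderiv_is_additive i : zmod_morphism (pderiv i).
Proof.
move=> a b; apply: smooth_ring_eq => x /set_mem Ux.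
have da c : derivable (ext (c : smooth_ring)) x (delta_mx 0 i).
  exact: smooth_derivable (smooth_ringP _) Ux.
have E : ext (a - b) = ext a - ext b by apply/funext => y; rewrite extD extN.
by rewrite extD extN !pderivE// /partial E (deriveB (da a) (da b)).
Qed.

HB.instance Definition _ i :=
  GRing.isZmodMorphism.Build smooth_ring smooth_ring (pderiv i)
    (pderiv_is_additive i).

Lemma pderivM i a b : pderiv i (a * b) = pderiv i a * b + a * pderiv i b.
Proof.
apply: smooth_ring_eq => x /set_mem Ux.
rewrite extD !extM !pderivE//.
have da c : derivable (ext (c : smooth_ring)) x (delta_mx 0 i).
  exact: smooth_derivable (smooth_ringP _) Ux.
have -> : ext (a * b) = ext a * ext b by apply/funext => y; rewrite extM.
by rewrite /partial (deriveM (da a) (da b)) addrC; congr (_ + _); exact: mulrC.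
Qed.

Lemma pderivC i j a : pderiv i (pderiv j a) = pderiv j (pderiv i a).
Proof.
have extd k b : {in U, ext (pderiv k b) =1 partial k (ext b)}.
  by move=> y /set_mem Uy; rewrite pderivE.
apply: smooth_ring_eq => x Ux; move: (Ux) => /set_mem Ux'.
have e1 := pderivE i (pderiv j a) Ux'.
have e2 := pderivE j (pderiv i a) Ux'.
have e3 := eq_partial oU i (extd j a) Ux.
have e4 := eq_partial oU j (extd i a) Ux.
have e5 := schwarz oU i j (smooth_ringP a) Ux'.
exact: etrans e1 (etrans e3 (etrans e5 (esym (etrans e2 e4)))).
Qed.

End SmoothRing.

(** * Evaluation at a point as a ring morphism *)

Section Evaluation.
Variables (R : realType) (N : nat) (U : set 'rV[R]_N) (oU : open U).
Implicit Types (p : {x | U x}) (h : 'rV[R]_N -> R) (a : smooth_ring oU).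

Definition ev p a : R := a p.

Lemma ev_is_additive p : zmod_morphism (ev p).
Proof. by []. Qed.

Lemma ev_is_multiplicative p : monoid_morphism (ev p).
Proof. by []. Qed.

HB.instance Definition _ p :=
  GRing.isZmodMorphism.Build (smooth_ring oU) R (ev p) (ev_is_additive p).
HB.instance Definition _ p :=
  GRing.isMonoidMorphism.Build (smooth_ring oU) R (ev p) (ev_is_multiplicative p).

Lemma ev_inj a b : (forall p, ev p a = ev p b) -> a = b.
Proof. by move=> ab; apply/val_inj/funext. Qed.

Lemma ev_pderiv i a h : (forall p, ev p a = h (sval p)) ->
  forall p, ev p (pderiv i a) = partial i h (sval p).
Proof.
move=> ah [x Ux]; have e := pderivE i a Ux.
rewrite (ext_in _ Ux) in e; rewrite [LHS]e /=.
apply: (eq_partial oU) => // [y /set_mem Uy|]; last by rewrite inE.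
by rewrite (ext_in _ Uy); exact: (ah (exist _ y Uy)).
Qed.

End Evaluation.

(* Abstract in the ring [A], so that conversion never unfolds the operations of
   a concrete ring of smooth functions. *)
Section Representation.
Variables (R : realType) (N : nat) (T : Type) (pt : T -> 'rV[R]_N).
Variables (A : comPzRingType) (ev : T -> {rmorphism A -> R}).
Variable d : 'I_N -> {additive A -> A}.

(** A relation rather than a map, since [h] is constrained only at the points [pt p]. *)
Definition represents (a : A) (h : 'rV[R]_N -> R) :=
  forall p, ev p a = h (pt p).

Hypothesis represents_partial : forall i a h,
  represents a h -> represents (d i a) (partial i h).
Variables (half : A) (gA hA : 'M[A]_N) (phiA : A).
Variables (G : 'rV[R]_N -> 'M[R]_N) (phi : 'rV[R]_N -> R).
Hypothesis halfK : half * 2 = 1.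
Hypothesis represents_g : forall i j, represents (gA i j) (fun x => G x i j).
Hypothesis represents_ginv : forall i j,
  represents (hA i j) (fun x => ginv G x i j).
Hypothesis represents_phi : represents phiA phi.

Lemma ev_half p : ev p half = 2^-1.
Proof.
have /(congr1 (ev p)) := halfK; rewrite rmorphM rmorph_nat rmorph1 => halfE.
have two_neq0 : (2 : R) != 0 by rewrite pnatr_eq0.
by apply: (mulIf two_neq0); rewrite halfE mulVf.
Qed.

Lemma represents_christoffel k i j :
  represents (rchristoffel d half gA hA k i j) (christoffel G k i j).
Proof.
move=> p; rewrite /christoffel rmorphM rmorph_sum ev_half; congr (_ * _).
apply: eq_bigr => l _; rewrite rmorphM rmorphB rmorphD represents_ginv.
by rewrite !(represents_partial _ (represents_g _ _)).
Qed.

Lemma represents_riem l i j k :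
  represents (rriem d half gA hA l i j k) (riem G l i j k).
Proof.
move=> p; rewrite /riem rmorphD rmorphB rmorph_sum; congr (_ - _ + _).
- exact: (represents_partial _ (represents_christoffel _ _ _)).
- exact: (represents_partial _ (represents_christoffel _ _ _)).
apply: eq_bigr => m _; rewrite rmorphB.
by congr (_ - _); rewrite rmorphM; congr (_ * _); exact: represents_christoffel.
Qed.

Lemma represents_ricci i j :
  represents (rricci d half gA hA i j) (fun x => ricci G x i j).
Proof.
move=> p; rewrite !mxE rmorph_sum; apply: eq_bigr => k _.
exact: represents_riem.
Qed.

Lemma represents_scal : represents (rscal d half gA hA) (scal G).
Proof.
move=> p; rewrite /scal /met_trace rmorph_sum; apply: eq_bigr => i _.
rewrite rmorph_sum; apply: eq_bigr => j _.
by rewrite rmorphM; congr (_ * _); [exact: represents_ginv | exact: represents_ricci].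
Qed.

Lemma represents_grad f h i : represents f h ->
  represents (rgrad d hA f 0 i) (fun x => grad G h x 0 i).
Proof.
move=> fh p; rewrite !mxE rmorph_sum; apply: eq_bigr => j _.
by rewrite rmorphM; congr (_ * _);
  [exact: represents_ginv | exact: (represents_partial _ fh)].
Qed.

Lemma represents_lap f h : represents f h ->
  represents (rlap d half gA hA f) (laplacian G h).
Proof.
move=> fh p; rewrite /laplacian /divergence rmorph_sum; apply: eq_bigr => i _.
rewrite rmorphD rmorph_sum; congr (_ + _).
  exact: (represents_partial _ (represents_grad _ fh)).
apply: eq_bigr => k _.
by rewrite rmorphM; congr (_ * _);
  [exact: represents_christoffel | exact: (represents_grad _ fh)].
Qed.

Lemma represents_hess i j :
  represents (rhess d half gA hA phiA i j) (fun x => hess G phi x i j).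
Proof.
move=> p; rewrite !mxE rmorphB rmorph_sum; congr (_ - _).
  exact: (represents_partial _ (represents_partial _ represents_phi)).
apply: eq_bigr => k _.
by rewrite rmorphM; congr (_ * _);
  [exact: represents_christoffel | exact: (represents_partial _ represents_phi)].
Qed.

Lemma represents_norm2 : represents (rnorm2 hA (rricci d half gA hA))
  (fun x => met_norm2 G x (ricci G x)).
Proof.
move=> p; rewrite rmorph_sum; apply: eq_bigr => i _.
rewrite rmorph_sum; apply: eq_bigr => j _.
rewrite rmorph_sum; apply: eq_bigr => k _.
rewrite rmorph_sum; apply: eq_bigr => l _.
rewrite !rmorphM; congr (_ * _ * _ * _);
  by [exact: represents_ginv | exact: represents_ricci].
Qed.

Hypothesis dM : forall i a b, d i (a * b) = d i a * b + a * d i b.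
Hypothesis dC : forall i j a, d i (d j a) = d j (d i a).
Hypothesis ev_inj : forall a b, (forall p, ev p a = ev p b) -> a = b.
Hypotheses (g_sym : gA^T = gA) (gK : hA *m gA = 1%:M) (hK : gA *m hA = 1%:M).

(** Joint injectivity of the evaluations lifts the pointwise soliton equation to the ring; [ev p]
    brings the conclusion back. *)
Lemma represented_laplacian_scal_soliton :
  (forall p, ricci G (pt p) + hess G phi (pt p) = G (pt p)) ->
  forall p, laplacian G (scal G) (pt p) =
    2 * scal G (pt p) - 2 * met_norm2 G (pt p) (ricci G (pt p))
    + 2 * ricci_form G (pt p) (grad G phi (pt p)).
Proof.
move=> sol p.
have solA : rricci d half gA hA + rhess d half gA hA phiA = gA.
  apply/matrixP => i j; apply: ev_inj => q; rewrite mxE rmorphD.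
  rewrite represents_ricci represents_hess represents_g.
  by have /matrixP/(_ i j) := sol q; rewrite mxE.
have := rlap_rscal_soliton dM dC halfK g_sym gK hK solA.
move/(congr1 (ev p)); rewrite (represents_lap represents_scal) => ->.
rewrite rmorphD rmorphB !rmorphM rmorph_nat represents_scal represents_norm2.
congr (_ + 2 * _).
have evu : map_mx (ev p) (rgrad d hA phiA) = grad G phi (pt p).
  apply/matrixP => i j; rewrite ord1 mxE.
  exact: (represents_grad j represents_phi p).
have evr : map_mx (ev p) (rricci d half gA hA) = ricci G (pt p).
  by apply/matrixP => i j; rewrite mxE; exact: (represents_ricci i j p).
by rewrite /ricci_form -evu -evr map_trmx -!map_mxM [RHS]mxE.
Qed.

End Representation.

(** * The metric of one chart as a matrix over the smooth ring *)

Section LocalSoliton.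
Variables (R : realType) (N : nat) (U : set 'rV[R]_N) (oU : open U).
Variables (G : 'rV[R]_N -> 'M[R]_N) (phi : 'rV[R]_N -> R).
Hypothesis G_smooth : forall i j, smooth_on U (fun x => G x i j).
Hypothesis G_sym : forall x, U x -> (G x)^T = G x.
Hypothesis G_pos : forall x, U x ->
  forall v : 'rV[R]_N, v != 0 -> 0 < (v *m G x *m v^T) 0 0.
Hypothesis phi_smooth : smooth_on U phi.

Let A : comPzRingType := smooth_ring oU.
Let d i : {additive A -> A} := pderiv (oU := oU) i.
Let half : A := to_smooth oU (fun k => Ck_cst oU k 2^-1).
Let gA : 'M[A]_N := \matrix_(i, j) to_smooth oU (G_smooth i j).
Let phiA : A := to_smooth oU phi_smooth.

Lemma half_mul2 : half * 2 = 1.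
Proof.
apply: ev_inj => p; rewrite rmorphM rmorph_nat rmorph1.
by apply: mulVf; rewrite pnatr_eq0.
Qed.

Lemma ev_gA p : map_mx (ev p) gA = G (sval p).
Proof. by apply/matrixP => i j; rewrite !mxE. Qed.

(** A nonzero kernel vector would be null for a positive definite form. *)
Lemma G_unit x : U x -> G x \in unitmx.
Proof.
move=> Ux; rewrite unitmxE unitfE; apply/negP => /det0P [v v0 vG].
by have := G_pos Ux v0; rewrite vG mul0mx mxE ltxx.
Qed.

Lemma det_gA_neq0 x : U x -> ext (\det gA : A) x != 0.
Proof.
move=> Ux; rewrite (ext_in _ Ux) -[_ (exist _ x Ux)]/(ev _ _).
by rewrite -det_map_mx ev_gA -unitfE -unitmxE G_unit.
Qed.

(** Cramer's rule: the determinant vanishes nowhere, so its reciprocal is smooth and the inverse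
    metric has entries in the ring. *)
Let idet : A :=
  to_smooth oU (fun k => CkV oU det_gA_neq0 (smooth_ringP (\det gA : A) k)).

Lemma idetK : idet * \det gA = 1.
Proof.
apply: ev_inj => -[x Ux]; rewrite rmorphM rmorph1.
have := mulVf (det_gA_neq0 Ux); rewrite [X in _ * X](ext_in _ Ux); exact.
Qed.

Let hA : 'M[A]_N := idet *: \adj gA.

Lemma gA_K : hA *m gA = 1%:M.
Proof. by rewrite -scalemxAl mul_adj_mx scale_scalar_mx idetK. Qed.

Lemma hA_K : gA *m hA = 1%:M.
Proof. by rewrite -scalemxAr mul_mx_adj scale_scalar_mx idetK. Qed.

Lemma gA_sym : gA^T = gA.
Proof.
apply/matrixP => i j; apply: ev_inj => -[x Ux].
have /matrixP/(_ i j) := G_sym Ux.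
by rewrite !mxE.
Qed.

Lemma ev_hA p : map_mx (ev p) hA = ginv G (sval p).
Proof.
have gh : G (sval p) *m map_mx (ev p) hA = 1%:M.
  by rewrite -ev_gA -map_mxM hA_K map_mx1.
have uG := G_unit (svalP p).
by rewrite -[LHS](mulKmx uG) gh mulmx1.
Qed.

Lemma laplacian_scal_soliton :
  (forall x, U x -> ricci G x + hess G phi x = G x) ->
  forall x, U x -> laplacian G (scal G) x =
    2 * scal G x - 2 * met_norm2 G x (ricci G x)
    + 2 * ricci_form G x (grad G phi x).
Proof.
move=> sol x Ux.
apply: (@represented_laplacian_scal_soliton R N {x | U x} sval A
  (fun p => ev (oU := oU) p) d _ half gA hA phiA G phi half_mul2 _ _ _
  (@pderivM _ _ _ oU) (@pderivC _ _ _ oU) (@ev_inj _ _ _ oU)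
  gA_sym gA_K hA_K _ (exist _ x Ux)).
- by move=> i a h; exact: ev_pderiv.
- by move=> i j p; rewrite mxE.
- by move=> i j p; rewrite -ev_hA [RHS]mxE.
- by [].
- by move=> p; apply: sol; exact: svalP p.
Qed.

End LocalSoliton.

(** * Signs and values of the constants *)

Section QCurvatureConstants.
Variables (R : realType) (N : nat).
Hypothesis N_ge4 : (4 <= N)%N.

Lemma Qa_gt0 : 0 < Qa R N.
Proof.
have : (4 : R) <= N%:R by rewrite ler_nat.
by move=> N4; rewrite invr_gt0; lra.
Qed.

Lemma Qb_gt0 : 0 < Qb R N.
Proof.
have : (4 : R) <= N%:R by rewrite ler_nat.
rewrite /Qb; move: (N%:R : R) => n n4.
(* Grouped this way, the first summand is nonnegative and the second positive for n >= 4. *)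
have -> : n ^+ 3 - 4 * n ^+ 2 + 16 * n - 16 = n ^+ 2 * (n - 4) + 16 * (n - 1).
  by ring.
apply: divr_gt0; last by rewrite !mulr_gt0 ?exprn_gt0//; lra.
by rewrite ltr_wpDl ?mulr_ge0 ?sqr_ge0 ?mulr_gt0//; lra.
Qed.

End QCurvatureConstants.

Lemma Qa4 (R : realType) : Qa R 4 = 6^-1.
Proof. by rewrite /Qa; field. Qed.

Lemma Qb4 (R : realType) : Qb R 4 = 6^-1.
Proof. by rewrite /Qb; field. Qed.

Lemma Qc4 (R : realType) : Qc R 4 = 2^-1.
Proof. by rewrite /Qc; field. Qed.

Theorem theorem1p6 (R : realType) (N : nat) (hN : (4 <= N)%N)
    (M : closedManifold R N) (g : riemannianMetric M) (f : M -> R)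
    (hsol : shrinking_soliton g f) :
  let a := Qa R N in
  let b := Qb R N in
  let c := Qc R N in
  [/\ (* the formula for the Q-curvature *)
      forall i x, chart_img i x ->
        QCurv g i x = (2 * a - c) * RicNorm2 g i x + b * Scal g i x ^+ 2
                      - 2 * a * Scal g i x - 2 * a * RicGrad g f i x,
      (* positivity, with the hypotheses holding on all of M *)
      (forall i x, chart_img i x -> 0 < RicGrad g f i x) ->
      (N = 4%N /\
         (forall i x, chart_img i x ->
            Scal g i x ^+ 2
            > RicNorm2 g i x + 2 * Scal g i x + 2 * RicGrad g f i x)) \/
      ((4 < N)%N /\
         (forall i x, chart_img i x ->
            [/\ (2 * a - c) * RicNorm2 g i x > 2 * a * RicGrad g f i x,
                2 * a * RicGrad g f i x > 0 &
                Scal g i x > 2 * a / b])) ->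
      forall i x, chart_img i x -> 0 < QCurv g i x
    & (* positivity at each point where the hypotheses hold *)
      forall i x, chart_img i x ->
      0 < RicGrad g f i x ->
      (N = 4%N /\
         Scal g i x ^+ 2
         > RicNorm2 g i x + 2 * Scal g i x + 2 * RicGrad g f i x) \/
      ((4 < N)%N /\
         [/\ (2 * a - c) * RicNorm2 g i x > 2 * a * RicGrad g f i x,
             2 * a * RicGrad g f i x > 0 &
             Scal g i x > 2 * a / b]) ->
      0 < QCurv g i x].
Proof.
move=> a b c.
have [_ f_smooth sol] := hsol.
have formula i x : chart_img i x ->
    QCurv g i x = (2 * a - c) * RicNorm2 g i x + b * Scal g i x ^+ 2
                  - 2 * a * Scal g i x - 2 * a * RicGrad g f i x.
  move=> Ux; rewrite /QCurv /Qcurv.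
  rewrite (laplacian_scal_soliton (@chart_img_open _ _ M i) (met_smooth g i)
             (@met_sym _ _ _ g i) (@met_pos _ _ _ g i) (f_smooth i)) //.
    rewrite /RicNorm2 /RicGrad /Scal /a /b /c; ring.
  by move=> y Uy; rewrite sol// scale1r.
(* Positivity is decided point by point; the global clause applies this everywhere. *)
have pos i x : chart_img i x ->
    (N = 4%N /\
       Scal g i x ^+ 2
       > RicNorm2 g i x + 2 * Scal g i x + 2 * RicGrad g f i x) \/
    ((4 < N)%N /\
       [/\ (2 * a - c) * RicNorm2 g i x > 2 * a * RicGrad g f i x,
           2 * a * RicGrad g f i x > 0 &
           Scal g i x > 2 * a / b]) ->
    0 < QCurv g i x.
  move=> Ux; rewrite formula// /a /b /c.
  move: (RicNorm2 _ _ _) (Scal _ _ _) (RicGrad _ _ _ _) => n s r.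
  case=> [[-> h]|[_ [h1 _ h2]]].
    (* Here 2a - c = -1/6, so 6Q is the difference of the two sides of [h]. *)
    by rewrite Qa4 Qb4 Qc4; lra.
  have b0 := Qb_gt0 R hN; have a0 := Qa_gt0 R hN.
  have s0 : 0 < s by apply: lt_trans h2; apply: divr_gt0 => //; apply: mulr_gt0.
  rewrite ltr_pdivrMr// in h2.
  have h3 : 0 < s * (s * Qb R N - 2 * Qa R N) by rewrite mulr_gt0 ?subr_gt0.
  rewrite -subr_gt0 in h1.
  (* The two positive quantities add up to Q. *)
  have := addr_gt0 h1 h3; congr (_ < _); ring.
split=> //.
- move=> _ H i x Ux; apply: pos => //.
  by case: H => -[hN' H]; [left | right]; split=> //; apply: H.
- by move=> i x Ux _; apply: pos.
Qed.
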